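(* Let $X$ be a real reflexive Banach space and let $A\colon X\to X^*$ be continuous, linear, and monotone. Then the three autoconjugate representers $\mathcal{A}_A$, $\mathcal{B}_A$, $\mathcal{C}_A$ for $A$ (defined in the context) all coincide with the function $$X\times X^*\to\left]-\infty,+\infty\right],\quad (x,x^* )\mapsto \langle x,x^*\rangle+q_{A_+}^*(x^*-Ax).$$
   Context: $X$ is a real reflexive Banach space with norm $\|\cdot\|$, continuous dual $X^*$ with dual norm $\|\cdot\|_*$, and pairing $\langle\cdot,\cdot\rangle$; $X^{**}$ is identified with $X$, and the dual of $X\times X^*$ is identified with $X^*\times X$. A linear operator $A\colon X\to X^*$ is monotone if $\langle x,Ax\rangle\ge 0$ for all $x\in X$; its graph is $\operatorname{gra}A=\{(x,Ax)\mid x\in X\}$. The adjoint $A^*$ is regarded as a map $X\to X^*$. Put $A_+=\tfrac12A+\tfrac12A^*$, $A_\circ=\tfrac12A-\tfrac12A^*$, and for a continuous linear $L\colon X\to X^*$ let $q_L\colon X\to\mathbb{R}$, $q_L(x)=\tfrac12\langle x,Lx\rangle$. For $f\colon X\to\left]-\infty,+\infty\right]$, the Fenchel conjugate is $f^*(x^* )=\sup_{x\in X}\langle x,x^*\rangle-f(x)$. For $F\colon X\times X^*\to\left]-\infty,+\infty\right]$, $F^*(x^*,x)=\sup_{(y,y^* )\in X\times X^*}\langle y,x^*\rangle+\langle x,y^*\rangle-F(y,y^* )$, and $F^{*\intercal}(x,x^* )=F^*(x^*,x)$. $F$ is autoconjugate if $F^*(x^*,x)=F(x,x^* )$ for all $(x,x^*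 )\in X\times X^*$; $F$ is a representer for $A$ if, for all $(x,x^* )$, $F(x,x^* )=\langle x,x^*\rangle$ holds exactly when $(x,x^* )\in\operatorname{gra}A$. An autoconjugate representer for $A$ is a function that is both. The Fitzpatrick function of $A$ is $F_A(x,x^* )=\sup_{(y,y^* )\in\operatorname{gra}A}\langle x,y^*\rangle+\langle y,x^*\rangle-\langle y,y^*\rangle$. For $(x,x^* )\in X\times X^*$ define $$\mathcal{A}_A(x,x^* )=\inf_{y^*\in X^*}\tfrac12F_A(x,x^*+y^* )+\tfrac12F_A^{*\intercal}(x,x^*-y^* ),$$ $$\mathcal{B}_A(x,x^* )=\inf_{(y,y^* )\in X\times X^*}\tfrac12F_A(x+y,x^*+y^* )+\tfrac12F_A^{*\intercal}(x-y,x^*-y^* )+\tfrac12\|y\|^2+\tfrac12\|y^*\|_*^2,$$ $$\mathcal{C}_A(x,x^* )=q_{A_+}(x)+q_{A_+}^*(x^*-A_\circ x).$$ *)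

(* Defs.v *)
From HB Require Import structures.
From mathcomp Require Import all_boot all_order all_algebra.
From mathcomp Require Import all_classical all_reals all_analysis.

Set Implicit Arguments.
Unset Strict Implicit.
Unset Printing Implicit Defensive.

Import Order.TTheory GRing.Theory Num.Theory.
Import numFieldNormedType.Exports.

Local Open Scope classical_set_scope.
Local Open Scope ring_scope.

HB.structure Definition LinearContinuous (R : realType)
    (X Y : normedModType R) :=
  {f of @GRing.Linear R X Y *:%R f & @Continuous X Y f}.

Notation "{ 'linear_continuous' X -> Y }" := (@LinearContinuous.type _ X Y)
  (at level 0, X at level 98, Y at level 99,
   format "{ 'linear_continuous'  X  ->  Y }") : type_scope.

Section linear_continuous_sub.
Context {R : realType} {X Y : normedModType R}.

Definition lincont : {pred X -> Y} :=
  mem [set f : X -> Y | linear f /\ continuous f].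

Section Sub.
Context (f : X -> Y) (fP : f \in lincont).
#[local] HB.instance Definition _ :=
  GRing.isLinear.Build R X Y *:%R f (set_mem fP).1.
#[local] HB.instance Definition _ :=
  isContinuous.Build X Y f (set_mem fP).2.
Definition lincont_Sub : {linear_continuous X -> Y} := f.
End Sub.

Lemma lincont_funP (f : {linear_continuous X -> Y}) : (f : X -> Y) \in lincont.
Proof. by rewrite inE; split; [exact: linearP|exact: cts_fun]. Qed.

Lemma lincont_rect (K : {linear_continuous X -> Y} -> Type) :
  (forall f (Pf : f \in lincont), K (lincont_Sub Pf)) -> forall u, K u.
Proof.
move=> Ksub [f [[P1] [P2] [P3]]].
have fP : f \in lincont.
  rewrite inE; split => // a x y.
  by case: P1 => _ ->; rewrite P2.
have := Ksub f fP; congr (K _); rewrite /lincont_Sub.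
congr LinearContinuous.Pack; congr LinearContinuous.Class.
- exact: (congr1 (@Algebra.isNmodMorphism.Axioms_ _ _ _)
    (Prop_irrelevance _ P1)).
- exact: (congr1 (@GRing.isScalable.Axioms_ _ _ _ _ _) (Prop_irrelevance _ P2)).
- exact: (congr1 (@isContinuous.Axioms_ _ _ _) (Prop_irrelevance _ P3)).
Qed.

Lemma lincont_valP f (Pf : f \in lincont) : lincont_Sub Pf = f :> (X -> Y).
Proof. by []. Qed.

HB.instance Definition _ :=
  isSub.Build _ _ {linear_continuous X -> Y} lincont_rect lincont_valP.

HB.instance Definition _ := [Choice of {linear_continuous X -> Y} by <:].

Lemma lincont_eqP (f g : {linear_continuous X -> Y}) : f = g <-> f =1 g.
Proof. by split=> [->//|fg]; exact/val_inj/funext. Qed.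

Lemma lincont_submod_closed : submod_closed lincont.
Proof.
split=> [|a f g /set_mem[lf cf] /set_mem[lg cg]]; rewrite inE.
  split; last by move=> x; exact: cst_continuous.
  by move=> a x y; rewrite /GRing.zero /= scaler0 addr0.
split=> [b x y|x]; last first.
  by apply: cvgD; [apply: cvgZr; exact: cf|exact: cg].
rewrite [LHS](_ : _ = a *: f (b *: x + y) + g (b *: x + y))//.
rewrite [RHS](_ : _ = b *: (a *: f x + g x) + (a *: f y + g y))//.
by rewrite lf lg !scalerDr addrACA !scalerA (mulrC a b).
Qed.

HB.instance Definition _ := GRing.isSubmodClosed.Build R (X -> Y) lincont
  lincont_submod_closed.

HB.instance Definition _ :=
  [SubChoice_isSubLmodule of {linear_continuous X -> Y} by <:].

End linear_continuous_sub.

Section operator_norm.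
Context {R : realType} {X Y : normedModType R}.
Implicit Types f g : {linear_continuous X -> Y}.

Definition opnorm f : R := sup [set `|f x| | x in [set x : X | `|x| <= 1]].

Let ball_image f := [set `|f x| | x in [set x : X | `|x| <= 1]].

Lemma lincont_bound f : exists2 r : R, 0 < r & forall x, `|f x| <= r * `|x|.
Proof.
have /linear_bounded_continuous/linear_boundedP := @cts_fun _ _ f.
by move=> /pinfty_ex_gt0[r r0 fr]; exists r.
Qed.

Lemma opnorm_has_sup f : has_sup (ball_image f).
Proof.
split; first by exists `|f 0|, 0 => //=; rewrite normr0 ler01.
have [r r0 fr] := lincont_bound f; exists r => _ [x /= x1 <-].
by rewrite (le_trans (fr x))// ler_piMr// ltW.
Qed.

Lemma opnorm_ge0 f : 0 <= opnorm f.
Proof.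
apply: (@le_trans _ _ `|f 0|) => //.
apply: (sup_upper_bound (opnorm_has_sup f)).
by exists 0 => //=; rewrite normr0 ler01.
Qed.

Lemma opnormP f x : `|f x| <= opnorm f * `|x|.
Proof.
have [->|x0] := eqVneq x 0; first by rewrite linear0 !normr0 mulr0.
rewrite -ler_pdivrMr ?normr_gt0// mulrC.
rewrite -[X in X * _]gtr0_norm ?invr_gt0 ?normr_gt0// -normrZ -linearZ.
apply: (sup_upper_bound (opnorm_has_sup f)); exists (`|x|^-1 *: x) => //=.
by rewrite normrZ normfV normr_id mulVf// normr_eq0.
Qed.

Lemma opnorm_le f (r : R) : 0 <= r -> (forall x, `|f x| <= r * `|x|) ->
  opnorm f <= r.
Proof.
move=> r0 fr; apply: sup_le_ub; first exact: (opnorm_has_sup f).1.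
by move=> _ [x /= x1 <-]; rewrite (le_trans (fr x))// ler_piMr.
Qed.

Lemma lincont_addE f g x : (f + g) x = f x + g x. Proof. by []. Qed.

Lemma lincont_scaleE (a : R) f x : (a *: f) x = a *: f x. Proof. by []. Qed.

Let opnormD f g : opnorm (f + g) <= opnorm f + opnorm g.
Proof.
apply: opnorm_le => [|x]; first by rewrite addr_ge0 ?opnorm_ge0.
by rewrite lincont_addE mulrDl (le_trans (ler_normD _ _))// lerD ?opnormP.
Qed.

Let opnormZ_le (a : R) f : opnorm (a *: f) <= `|a| * opnorm f.
Proof.
apply: opnorm_le => [|x]; first by rewrite mulr_ge0 ?opnorm_ge0.
by rewrite lincont_scaleE normrZ -mulrA ler_wpM2l ?opnormP.
Qed.

Let opnormZ (a : R) f : opnorm (a *: f) = `|a| * opnorm f.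
Proof.
apply/eqP; rewrite eq_le opnormZ_le/=.
have [->|a0] := eqVneq a 0; first by rewrite normr0 mul0r opnorm_ge0.
rewrite -ler_pdivlMl ?normr_gt0// -normfV.
by rewrite (le_trans _ (opnormZ_le _ _))// scalerA mulVf// scale1r.
Qed.

Let opnorm_eq0 f : opnorm f = 0 -> f = 0.
Proof.
move=> f0; apply/lincont_eqP => x; apply/eqP.
by rewrite -normr_le0 (le_trans (opnormP f x))// f0 mul0r.
Qed.

HB.instance Definition _ :=
  @Lmodule_isNormed.Build R {linear_continuous X -> Y} opnorm
    opnormD opnormZ opnorm_eq0.

Lemma opnormE f : `|f| = opnorm f. Proof. by []. Qed.

Lemma le_lincont_norm f x : `|f x| <= `|f| * `|x|.
Proof. exact: opnormP. Qed.

End operator_norm.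

(** For [x : X] and [x' : dual X], the pairing of [x] and [x'] is written as the
    application [x' x]. *)

Definition dual {R : realType} (X : normedModType R) :=
  {linear_continuous X -> R^o}.

HB.instance Definition _ (R : realType) (X : normedModType R) :=
  NormedModule.on (dual X).

Section duality.
Context {R : realType}.
Implicit Types X Y : normedModType R.

Lemma bounded_lincont X Y (f : X -> Y) (r : R) :
  linear f -> (forall x, `|f x| <= r * `|x|) -> f \in lincont.
Proof.
move=> lf fr; rewrite inE; split=> //.
pose g : {linear X -> Y} := HB.pack f (GRing.isLinear.Build R X Y *:%R f lf).
apply: (@bounded_linear_continuous _ _ _ g); apply/linear_boundedP.
near=> s => x; rewrite (le_trans (fr x))// ler_wpM2r//.
Unshelve. all: by end_near. Qed.

Section evaluation.
Context {X : normedModType R}.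

Lemma evaluation_lincont (x : X) :
  (fun x' : dual X => x' x : R^o) \in lincont.
Proof.
apply: (@bounded_lincont _ _ _ `|x|) => [a x' y'//|x'].
by rewrite mulrC le_lincont_norm.
Qed.

Definition evaluation (x : X) : dual (dual X) :=
  lincont_Sub (evaluation_lincont x).

Lemma to_bidual_lincont : evaluation \in lincont.
Proof.
apply: (@bounded_lincont _ _ _ 1) => [a x y|x].
  by apply/lincont_eqP => x'; exact: linearP.
apply: opnorm_le => [|x']; first by rewrite mulr_ge0.
by rewrite mul1r mulrC; exact: (le_lincont_norm x' x).
Qed.

Definition to_bidual : {linear_continuous X -> dual (dual X)} :=
  lincont_Sub to_bidual_lincont.

Definition reflexive_space := set_surj [set: X] [set: dual (dual X)] to_bidual.

End evaluation.

Section composition.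
Context {X Y Z : normedModType R}.

Lemma lincont_comp_subproof (g : {linear_continuous Y -> Z})
  (f : {linear_continuous X -> Y}) : (g \o f : X -> Z) \in lincont.
Proof.
rewrite inE; split=> [a x y|x]; first by rewrite /= !linearP.
by apply: continuous_comp; exact: cts_fun.
Qed.

Definition lincont_comp (g : {linear_continuous Y -> Z})
    (f : {linear_continuous X -> Y}) : {linear_continuous X -> Z} :=
  lincont_Sub (lincont_comp_subproof g f).

End composition.

Section transposition.
Context {X Y : normedModType R} (L : {linear_continuous X -> Y}).

Lemma transpose_lincont :
  (fun y' : dual Y => lincont_comp y' L : dual X) \in lincont.
Proof.
apply: (@bounded_lincont _ _ _ `|L|) => [a y' z'|y'].
  exact/lincont_eqP.
apply: opnorm_le => [|x]; first by rewrite mulr_ge0.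
rewrite mulrAC mulrC; apply: (le_trans (le_lincont_norm y' (L x))).
by rewrite ler_wpM2l// le_lincont_norm.
Qed.

Definition transpose : {linear_continuous dual Y -> dual X} :=
  lincont_Sub transpose_lincont.

End transposition.

End duality.

Arguments reflexive_space {R} X.

Section monotone_operators.
Context {R : realType} {X : normedModType R}.
Implicit Types (L A : {linear_continuous X -> dual X}).
Implicit Types (F : X * dual X -> \bar R) (G : dual X * X -> \bar R).

Definition monotone_operator A := forall x, 0 <= A x x.

Definition gra A : set (X * dual X) := range (fun x => (x, A x)).

(** The adjoint maps the bidual of [X] to [dual X]; it is regarded as a map on
    [X] through the canonical embedding. *)
Definition adjoint A : {linear_continuous X -> dual X} :=
  lincont_comp (transpose A) to_bidual.

Lemma adjointE A x y : adjoint A x y = A y x. Proof. by []. Qed.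

Definition sym_part A : {linear_continuous X -> dual X} :=
  2^-1 *: A + 2^-1 *: adjoint A.

Definition skew_part A : {linear_continuous X -> dual X} :=
  2^-1 *: A - 2^-1 *: adjoint A.

Lemma sym_partE A x y : sym_part A x y = 2^-1 * A x y + 2^-1 * A y x.
Proof. by rewrite /sym_part !lincont_addE !lincont_scaleE adjointE. Qed.

Lemma skew_partE A x y : skew_part A x y = 2^-1 * A x y - 2^-1 * A y x.
Proof.
rewrite /skew_part -scalerN -scaleN1r !lincont_addE !lincont_scaleE adjointE.
by rewrite !scaleN1r -scalerN.
Qed.

Definition quad L (x : X) : R := 2^-1 * L x x.

Local Open Scope ereal_scope.

Definition conjugate (f : X -> \bar R) (x' : dual X) : \bar R :=
  ereal_sup (range (fun x : X => (x' x)%:E - f x)).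

Definition conjugate2 F (p : dual X * X) : \bar R :=
  ereal_sup (range (fun z : X * dual X => (p.1 z.1 + z.2 p.2)%:E - F z)).

Definition swap G (p : X * dual X) : \bar R := G (p.2, p.1).

Definition autoconjugate F :=
  forall x (x' : dual X), conjugate2 F (x', x) = F (x, x').

Definition representer A F :=
  forall x (x' : dual X), F (x, x') = (x' x)%:E <-> gra A (x, x').

(** The first clause says that [F] takes its values in ]-oo, +oo]. *)
Definition autoconjugate_representer A F :=
  [/\ forall p, F p != -oo, autoconjugate F & representer A F].

Definition fitzpatrick A (p : X * dual X) : \bar R :=
  ereal_sup
    ((fun z : X * dual X => (z.2 p.1 + p.2 z.1 - z.2 z.1)%:E) @` gra A).

Definition calA A (p : X * dual X) : \bar R :=
  ereal_inf [set
    2^-1%:E * fitzpatrick A (p.1, p.2 + y')%R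
    + 2^-1%:E * swap (conjugate2 (fitzpatrick A)) (p.1, p.2 - y')%R
    | y' in [set: dual X]].

Definition calB A (p : X * dual X) : \bar R :=
  ereal_inf [set
    2^-1%:E * fitzpatrick A (p.1 + z.1, p.2 + z.2)%R
    + 2^-1%:E * swap (conjugate2 (fitzpatrick A)) (p.1 - z.1, p.2 - z.2)%R
    + (2^-1 * `|z.1| ^+ 2)%:E + (2^-1 * `|z.2| ^+ 2)%:E
    | z in [set: X * dual X]].

Definition calC A (p : X * dual X) : \bar R :=
  (quad (sym_part A) p.1)%:E
  + conjugate (EFin \o quad (sym_part A)) (p.2 - skew_part A p.1)%R.

End monotone_operators.

(* Main.v *)
From HB Require Import structures.
Require Import Defs.
From mathcomp Require Import all_boot all_order all_algebra.
From mathcomp Require Import all_classical all_reals all_analysis.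
From mathcomp Require Import ring lra.
Import Order.TTheory GRing.Theory Num.Theory.
Import numFieldNormedType.Exports.

(** Write [q x] for [2^-1 * A x x], [q*] for its conjugate ([qconj] below), and
    [G (x, v) = v x + q* (v - A x)] for the common value ([common_rep]).

    Everything rests on two closed forms.  Substituting [y = x + w / 2] in the
    supremum that defines the Fitzpatrick function gives
    [F_A (x, v) = v x + q* (v - A x) / 2] ([fitzpatrickE]).  The transposed
    conjugate of [F_A] is [A x x] at the points [(x, A x)] of the graph and
    [+oo] elsewhere ([fitzpatrick_conj_gra], [fitzpatrick_conj_notin_gra]);
    this uses that [q] is its own biconjugate, which is explicit here since the
    conjugate of [q] at [A_+ x] is [q x].

    Consequently the infimum defining [calA] is carried by a single point, and
    2-homogeneity of [q*] turns its value into [G].  For [calC] it suffices to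
    translate the supremum in the conjugate by [x].  The infimum defining [calB]
    is carried by the pairs [(u, v - A x + A u)], and at such a pair the
    expression is [G (x, v) + h u], where
    [h u = A u u + z u + |u|^2 / 2 + |z + A u|^2 / 2] and [z = v - A x].
    Now [h >= 0] by the Cauchy-Schwarz inequality of the pairing, so the claim
    for [calB] is that [inf h = 0]: this is the substance of Rockafellar's
    theorem that [A + J] is onto, with [J] the duality map, and it is where
    reflexivity enters.

    That infimum is computed by Fenchel duality ([rockafellar]).  If [m] is a
    lower bound of [h], perturbing the two norm terms by [(a, b)] and applying
    Hahn-Banach to the resulting value function yields a continuous linear
    functional on the product of [X] and its dual ([lagrange_multiplier]);
    reflexivity represents it by some [(z', z)], and choosing [u = - z] makes
    the monotone form cancel, leaving [m <= - z' z - |z'|^2 / 2 - |z|^2 / 2],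
    which is at most [0].  Hahn-Banach itself is proved in the form: a convex
    function vanishing at [0] dominates a linear one, because a minimal such
    function is linear.

    Finally [G] is autoconjugate and represents [A], again because [q] is its
    own biconjugate and because [q*] is nonnegative and vanishes only at [0]. *)

Local Open Scope classical_set_scope.
Local Open Scope ring_scope.

(** * Convex functions, Hahn-Banach and Lagrange multipliers *)

Section hahn_banach.
Context {R : realType}.
Implicit Types U V : lmodType R.

Definition convex_fun {V} (p : V -> R) := forall a b (t : R), 0 <= t <= 1 ->
  p (t *: a + (1 - t) *: b) <= t * p a + (1 - t) * p b.

Lemma half_add_half_opp {V} (a : V) : 2^-1 *: a + (1 - 2^-1) *: (- a) = 0 :> V.
Proof. by rewrite scalerN (_ : 1 - 2^-1 = 2^-1 :> R) ?subrr//; lra. Qed.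

Lemma convex_fun_ge_opp {V} {p : V -> R} : convex_fun p -> p 0 = 0 ->
  forall a, - p (- a) <= p a.
Proof.
move=> cp p0 a; have := cp a (- a) 2^-1 ltac:(lra).
rewrite half_add_half_opp p0; lra.
Qed.

(** Partial minimisation preserves convexity: near-minimisers [u] for [a] and
    [v] for [b] are combined into a competitor for the combination of [a] and
    [b].  The bound [lb] only keeps the infima finite. *)
Lemma convex_fun_inf {U V} {C : set U} {H : U -> V -> R} (lb : V -> R) :
  C !=set0 ->
  (forall u v t, 0 <= t <= 1 -> C u -> C v -> C (t *: u + (1 - t) *: v)) ->
  (forall u v a b t, 0 <= t <= 1 -> C u -> C v ->
    H (t *: u + (1 - t) *: v) (t *: a + (1 - t) *: b)
    <= t * H u a + (1 - t) * H v b) ->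
  (forall u a, C u -> lb a <= H u a) ->
  convex_fun (fun a => inf [set H u a | u in C]).
Proof.
move=> [u0 Cu0] cC cH Hlb a b t t01.
have hi c : has_inf [set H u c | u in C].
  split; first by exists (H u0 c), u0.
  by exists (lb c) => _ [u Cu <-]; exact: Hlb.
apply/ler_addgt0Pl => e e0.
have [_ [u Cu <-] ua] := inf_adherent e0 (hi a).
have [_ [v Cv <-] vb] := inf_adherent e0 (hi b).
apply: (@le_trans _ _ (H (t *: u + (1 - t) *: v) (t *: a + (1 - t) *: b))).
  apply: ge_inf; first exact: (hi _).2.
  by exists (t *: u + (1 - t) *: v) => //; exact: cC.
apply: (le_trans (cH _ _ _ _ _ t01 Cu Cv)); nra.
Qed.

(** By Zorn's lemma, since a chain has a pointwise infimum: the members stay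
    above [- p (- a)] by [convex_fun_ge_opp], and of two members of a chain one
    is below the other, so the infimum is still convex. *)
Lemma minimal_convex_fun {V} (p : V -> R) : convex_fun p -> p 0 = 0 ->
  exists f : V -> R, [/\ convex_fun f, f 0 = 0, forall a, f a <= p a &
    forall g, convex_fun g -> g 0 = 0 -> (forall a, g a <= f a) -> g =1 f].
Proof.
move=> cp p0.
pose T := {f : V -> R | [/\ convex_fun f, f 0 = 0 & forall a, f a <= p a]}.
pose below (f g : T) := `[< forall a, sval g a <= sval f a >].
have [] := @Zorn T below.
- by move=> f; apply/asboolP.
- move=> f g h /asboolP gf /asboolP hg; apply/asboolP => a.
  exact: le_trans (hg a) (gf a).
- move=> [f Pf] [g Pg] /asboolP gf /asboolP fg; apply: eq_exist => /=.
  by apply/funext => a; apply/eqP; rewrite eq_le (fg a) (gf a).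
- move=> A totA; have [[f0 Af0]|A0] := pselect (A !=set0); last first.
    exists (exist _ p (And3 cp p0 (fun=> lexx _))) => f Af.
    by exfalso; apply: A0; exists f.
  have hi a : has_inf [set sval f a | f in A].
    split; first by exists (sval f0 a), f0.
    exists (- p (- a)) => _ [f Af <-].
    case: (svalP f) => cf f00 fp.
    by rewrite (le_trans _ (convex_fun_ge_opp cf f00 a))// lerN2.
  pose h a := inf [set sval f a | f in A].
  have hle f a : A f -> h a <= sval f a.
    by move=> Af; apply: ge_inf; [exact: (hi a).2|exists f].
  have ch : convex_fun h.
    move=> a b t t01; apply/ler_addgt0Pl => e e0.
    have [_ [f Af <-] fa] := inf_adherent e0 (hi a).
    have [_ [g Ag <-] gb] := inf_adherent e0 (hi b).
    have [k [Ak kf kg]] : exists k, [/\ A k, forall c, sval k c <= sval f c &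
        forall c, sval k c <= sval g c].
      by have [/asboolP gf|/asboolP fg] := totA _ _ Af Ag; [exists g|exists f].
    apply: (le_trans (hle k _ Ak)).
    case: (svalP k) => ck _ _; apply: (le_trans (ck _ _ _ t01)).
    have := kf a; have := kg b; rewrite -/(h a) -/(h b) in fa gb *; nra.
  have h0 : h 0 = 0.
    rewrite /h (_ : [set _ | _ in _] = [set 0]) ?inf1//.
    apply/seteqP; split => [_ [f _ <-]|_ ->]; first by case: (svalP f).
    by exists f0 => //; case: (svalP f0).
  have hp a : h a <= p a.
    by apply: (le_trans (hle f0 a Af0)); case: (svalP f0).
  exists (exist _ h (And3 ch h0 hp)) => f Af.
  by apply/asboolP => a; exact: hle.
- move=> [f [cf f0 fp]] fmin; exists f; split=> // g cg g0 gf.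
  have gp a : g a <= p a by exact: le_trans (gf a) (fp a).
  have -> : g = f.
    apply: (congr1 (fun h : T => sval h) (fmin (exist _ g (And3 cg g0 gp)) _)).
    exact/asboolP.
  by [].
Qed.

(** For [0 < t <= 1] the function [a |-> t^-1 * f (t *: a)] is convex and lies
    below [f], so it equals [f] by minimality. *)
Lemma minimal_convex_funZ {V} (f : V -> R) : convex_fun f -> f 0 = 0 ->
  (forall g, convex_fun g -> g 0 = 0 -> (forall a, g a <= f a) -> g =1 f) ->
  forall t a, 0 < t -> f (t *: a) = t * f a.
Proof.
move=> cf f0 fmin.
have small t a : 0 < t <= 1 -> f (t *: a) = t * f a.
  move=> /andP[t0 t1].
  suff /(_ a) <- : (fun b => t^-1 * f (t *: b)) =1 f.
    by rewrite mulrA divff ?mul1r// gt_eqF.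
  apply: fmin => [b c s s01||b].
  - rewrite scalerDr !scalerA !(mulrC t) -!scalerA.
    have := cf (t *: b) (t *: c) s s01.
    rewrite -(ler_pM2l (x := t^-1)) ?invr_gt0// => /le_trans; apply.
    by rewrite le_eqVlt; apply/orP; left; apply/eqP; ring.
  - by rewrite scaler0 f0 mulr0.
  - rewrite ler_pdivrMl//.
    by have := cf b 0 t ltac:(lra); rewrite scaler0 addr0 f0 mulr0 addr0.
move=> t a t0; have [t1|t1] := leP t 1; first by apply: small; rewrite t0.
have := small t^-1 (t *: a).
rewrite scalerA mulVf ?gt_eqF// scale1r invr_gt0 t0 invf_le1// ltW// => /(_ isT) ->.
by rewrite mulrA divff ?mul1r// gt_eqF.
Qed.

(** Subadditivity is convexity at the midpoint together with homogeneity.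
    Superadditivity is minimality against [a |-> inf_(t >= 0) f (a + t *: b) -
    t * f b], a convex function below [f] whose value at [a] is at most
    [f (a + b) - f b] (take [t = 1]). *)
Lemma minimal_convex_funD {V} (f : V -> R) : convex_fun f -> f 0 = 0 ->
  (forall g, convex_fun g -> g 0 = 0 -> (forall a, g a <= f a) -> g =1 f) ->
  {morph f : a b / a + b}.
Proof.
move=> cf f0 fmin; have fZ := @minimal_convex_funZ _ _ cf f0 fmin.
have subadd a b : f (a + b) <= f a + f b.
  have := cf (2 *: a) (2 *: b) 2^-1 ltac:(lra).
  rewrite (_ : 1 - 2^-1 = 2^-1 :> R); last by lra.
  rewrite !scalerA mulVf ?scale1r// !fZ//; lra.
have super a b : f a + f b <= f (a + b).
  pose C := [set t : R^o | 0 <= t].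
  pose H (t : R^o) a := f (a + t *: b) - t * f b.
  have lbH t c : C t -> - f (- c) <= H t c.
    rewrite /C /H /= le_eqVlt => /predU1P[<-|t0].
      by rewrite scale0r addr0 mul0r subr0 convex_fun_ge_opp.
    have := subadd (c + t *: b) (- c).
    by rewrite addrAC subrr add0r fZ//; lra.
  have hi c : has_lbound [set H u c | u in C].
    by exists (- f (- c)) => _ [u Cu <-]; exact: lbH.
  have C0 : C 0 by rewrite /C /=.
  have C1 : C 1 by rewrite /C /= ler01.
  suff fa : inf [set H u a | u in C] = f a.
    have : f a <= H 1 a by rewrite -fa; apply: ge_inf => //; exists 1.
    by rewrite /H scale1r mul1r; lra.
  move: a; apply: fmin => [||c].
  - apply: (convex_fun_inf (fun c => - f (- c))) => //; first by exists 0.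
      rewrite /C /= /GRing.scale /= => u v t t01 u0 v0; nra.
    move=> u v a c t t01 Cu Cv; rewrite /H.
    have -> : t *: u + (1 - t) *: v = t * u + (1 - t) * v :> R^o by [].
    have -> : t *: a + (1 - t) *: c + (t * u + (1 - t) * v) *: b
        = t *: (a + u *: b) + (1 - t) *: (c + v *: b).
      by rewrite (scalerDl b) !scalerDr addrACA !scalerA.
    have := cf (a + u *: b) (c + v *: b) t t01; lra.
  - rewrite (_ : [set _ | _ in _] = [set 0]) ?inf1//.
    apply/seteqP; split => [_ [t + <-]|_ ->] /=.
      rewrite /C /H /= add0r le_eqVlt => /predU1P[<-|t0].
        by rewrite scale0r mul0r f0 subr0.
      by rewrite fZ// subrr.
    by exists 0 => //; rewrite /H scale0r addr0 mul0r f0 subr0.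
  - apply: ge_inf => //; exists 0 => //.
    by rewrite /H scale0r addr0 mul0r subr0.
by move=> a b; apply/eqP; rewrite eq_le subadd super.
Qed.

(** A minimal convex function below [p] is linear: it is additive and
    positively homogeneous, and additivity gives the negative scalars. *)
Lemma hahn_banach {V} (p : V -> R) : convex_fun p -> p 0 = 0 ->
  exists2 l : V -> R^o, linear l & forall a, l a <= p a.
Proof.
move=> cp p0; have [f [cf f0 fp fmin]] := minimal_convex_fun p cp p0.
have fD := minimal_convex_funD f cf f0 fmin.
have fZ := minimal_convex_funZ f cf f0 fmin.
have fN a : f (- a) = - f a.
  by apply/eqP; rewrite -addr_eq0 -fD addrC subrr f0.
exists f => // t a b; rewrite fD; congr (_ + _).
have [t0|t0|<-] := ltgtP 0 t; first exact: fZ.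
  by apply: oppr_inj; rewrite -fN -scaleNr fZ ?oppr_gt0// mulNr.
by rewrite scale0r f0 scale0r.
Qed.

(** The functional is a subgradient at [0] of the value function
    [p a = inf_u H u a].  That function is finite because midpoint convexity
    through [a] and [- a] bounds [H u a] below by [2 * m - H 0 (- a)]. *)
Lemma lagrange_multiplier {U V} (H : U -> V -> R) (m : R) :
  (forall u v a b t, 0 <= t <= 1 ->
    H (t *: u + (1 - t) *: v) (t *: a + (1 - t) *: b)
    <= t * H u a + (1 - t) * H v b) ->
  (forall u, m <= H u 0) ->
  exists2 l : V -> R^o, linear l & forall u a, m + l a <= H u a.
Proof.
move=> cH mH.
pose p a := inf (range (H^~ a)).
have lbH u a : 2 * m - H 0 (- a) <= H u a.
  have := cH u 0 a (- a) 2^-1 ltac:(lra); rewrite half_add_half_opp.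
  have := mH (2^-1 *: u + (1 - 2^-1) *: 0); lra.
have pH u a : p a <= H u a.
  by apply: ge_inf; [exists (2 * m - H 0 (- a)) => _ [v _ <-]|exists u].
have mp : m <= p 0.
  by apply: lb_le_inf => [|_ [u _ <-]]; [exists (H 0 0), 0|exact: mH].
have cp : convex_fun p.
  by apply: (convex_fun_inf (fun a => 2 * m - H 0 (- a))) => //;
    [exists 0|move=> u v a b t t01 _ _; exact: cH].
have [||l ll lp] := hahn_banach (fun a => p a - p 0).
- by move=> a b t t01; have := cp a b t t01; lra.
- by rewrite subrr.
- by exists l => // u a; have := lp a; have := pH u a; lra.
Qed.

End hahn_banach.

(** * Rockafellar's duality argument in a reflexive space *)

Section rockafellar.
Context {R : realType}.
Implicit Types X Y : normedModType R.

(** An upper bound on the unit ball makes a linear functional bounded, as the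
    ball is symmetric. *)
Lemma dual_of_upper_bounded {Y} (l : Y -> R^o) (c : R) : linear l ->
  (forall y, `|y| <= 1 -> l y <= c) -> exists phi : dual Y, forall y, phi y = l y.
Proof.
move=> ll lc.
pose g : {linear Y -> R^o} := HB.pack l (GRing.isLinear.Build R Y R^o *:%R l ll).
have l0 : l 0 = 0 := linear0 g.
have lN : {morph l : y / - y} := linearN g.
have lZ : scalable l := linearZ_LR g.
have lbound y : l y <= c * `|y|.
  have [->|y0] := eqVneq y 0; first by rewrite l0 normr0 mulr0.
  have y0' : 0 < `|y| by rewrite normr_gt0.
  have := lc (`|y|^-1 *: y); rewrite normrZ normfV normr_id mulVf ?gt_eqF//.
  move=> /(_ (lexx _)); rewrite lZ -ler_pdivrMr// mulrC.
  exact.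
have lP : l \in lincont.
  apply: (@bounded_lincont _ _ _ _ c) => // y; rewrite ler_norml lbound andbT.
  by rewrite lerNl -lN -(normrN y) lbound.
by exists (lincont_Sub lP).
Qed.

(** This is half of the fact that the conjugate of [|y|^2 / 2] is
    [|phi|^2 / 2]: optimise the hypothesis along each ray, at the length
    [|phi|], without assuming that the norm of [phi] is attained. *)
Lemma half_sqr_dual_norm_le {Y} (phi : dual Y) (c : R) :
  (forall y, phi y <= c + 2^-1 * `|y| ^+ 2) -> 2^-1 * `|phi| ^+ 2 <= c.
Proof.
move=> phic; set r := `|phi|.
have : 0 <= r by exact: normr_ge0.
rewrite le_eqVlt => /predU1P[<-|r0].
  by have := phic 0; rewrite linear0 normr0 expr0n/= mulr0 addr0.
have scaled s y : s * phi y <= c + 2^-1 * (s ^+ 2 * `|y| ^+ 2).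
  by have := phic (s *: y); rewrite linearZ normrZ exprMn real_normK ?num_real.
have : r <= (c + 2^-1 * r ^+ 2) / r.
  rewrite {1}/r opnormE; apply: opnorm_le => [|x].
    rewrite divr_ge0//; last exact: ltW.
    by have := phic 0; rewrite linear0 normr0; have := sqr_ge0 r; lra.
  have [->|x0] := eqVneq x 0; first by rewrite linear0 !normr0 mulr0.
  have x0' : 0 < `|x| by rewrite normr_gt0.
  have xV : `|x| * `|x|^-1 = 1 by rewrite divff// gt_eqF.
  rewrite mulrAC ler_pdivlMr// -ler_pdivrMr//.
  have := scaled (r / `|x|) x; have := scaled (- (r / `|x|)) x.
  rewrite sqrrN -exprMn divfK ?gt_eqF// => h1 h2.
  have abs_mul_le (p s k : R) : 0 <= s -> s * p <= k -> - s * p <= k -> `|p| * s <= k.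
    by move=> s0; case: (ger0P p) => _; lra.
  by rewrite -mulrA; apply: abs_mul_le; rewrite ?divr_ge0// ?ltW.
rewrite ler_pdivlMr//; lra.
Qed.

Lemma convex_fun_sqr_norm {Y} : convex_fun (fun y : Y => `|y| ^+ 2).
Proof.
move=> a b t /andP[t0 t1].
have : `|t *: a + (1 - t) *: b| <= t * `|a| + (1 - t) * `|b|.
  apply: (le_trans (ler_normD _ _)); rewrite !normrZ !ger0_norm//; lra.
have := normr_ge0 (t *: a + (1 - t) *: b); have := normr_ge0 a.
have := normr_ge0 b; move: `|_ + _| `|a| `|b| => z x y y0 x0 z0 zxy.
have : z ^+ 2 <= (t * x + (1 - t) * y) ^+ 2 by rewrite ler_pXn2r ?nnegrE//; nra.
have : 0 <= t * (1 - t) * (x - y) ^+ 2.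
  by rewrite mulr_ge0 ?sqr_ge0// mulr_ge0//; lra.
lra.
Qed.

Section bilinear.
Context {X : normedModType R} (A : {linear_continuous X -> dual X}).

Lemma linopD x y z : A (x + y) z = A x z + A y z.
Proof. by rewrite linearD. Qed.

Lemma linopN x z : A (- x) z = - A x z.
Proof. by rewrite linearN. Qed.

Lemma linopZ (t : R) x z : A (t *: x) z = t * A x z.
Proof. by rewrite linearZ. Qed.

Lemma dualD (f : dual X) x y : f (x + y) = f x + f y :> R.
Proof. by rewrite linearD. Qed.

Lemma dualN (f : dual X) x : f (- x) = - f x :> R.
Proof. by rewrite linearN. Qed.

Lemma dualZ (f : dual X) (t : R) x : f (t *: x) = t * f x :> R.
Proof. by rewrite linearZ. Qed.

Lemma convex_fun_monotone_form : monotone_operator A -> convex_fun (fun x => A x x).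
Proof.
move=> mA a b t /andP[t0 t1].
have := mA (a - b); rewrite !linopD !linopN !linopZ !dualD !dualN !dualZ => h.
have : 0 <= t * (1 - t) * (A a a - A a b - A b a + A b b).
  by rewrite mulr_ge0// ?mulr_ge0//; lra.
lra.
Qed.

End bilinear.

Lemma affine_comb {V : lmodType R} (t : R) (v a a' b b' : V) :
  t *: (v + a + b) + (1 - t) *: (v + a' + b')
  = v + (t *: a + (1 - t) *: a') + (t *: b + (1 - t) *: b').
Proof.
rewrite !scalerDr addrACA; congr (_ + _).
by rewrite addrACA -scalerDl [t + _]addrC subrK scale1r.
Qed.

(** The infimum of a function of this shape is at most [0].  The multiplier
    [(z', z'')] of the perturbed problem satisfies, once [z''] is evaluation at
    [z] and [u = - z], an inequality in which [A] no longer appears; the two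
    Fenchel inequalities for the squared norms then conclude. *)
Lemma rockafellar {X} (A : {linear_continuous X -> dual X}) (v : dual X) (m : R) :
  reflexive_space X -> monotone_operator A ->
  (forall u, m <= A u u + v u + 2^-1 * `|u| ^+ 2 + 2^-1 * `|v + A u| ^+ 2) ->
  m <= 0.
Proof.
move=> rX mA mle.
(* The two norm terms are perturbed independently; [w = 0] gives back the
   function of the hypothesis. *)
pose H (u : X) (w : X * dual X) := A u u + v u + 2^-1 * `|u + w.1| ^+ 2
  + 2^-1 * `|v + A u + w.2| ^+ 2.
have [|u|l ll lH] := lagrange_multiplier H m.
- move=> u u' [a b] [a' b'] t t01; rewrite /H /=.
  have := convex_fun_monotone_form A mA u u' t t01.
  have := convex_fun_sqr_norm (u + a) (u' + a') t t01.
  have := convex_fun_sqr_norm (v + A u + b) (v + A u' + b') t t01.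
  have -> : t *: (u + a) + (1 - t) *: (u' + a')
      = t *: u + (1 - t) *: u' + (t *: a + (1 - t) *: a').
    by rewrite !scalerDr addrACA.
  have -> : t *: (v + A u + b) + (1 - t) *: (v + A u' + b')
      = v + A (t *: u + (1 - t) *: u') + (t *: b + (1 - t) *: b').
    by rewrite affine_comb (linearD A) !(linearZ_LR A).
  rewrite /= (dualD v) !(dualZ v); lra.
- by rewrite /H /= !addr0.
have lD a b : l (a + b) = l a + l b by have := ll 1 a b; rewrite !scale1r.
have bound1 (w : X * dual X) : l w <= 2^-1 * `|w.1| ^+ 2
    + 2^-1 * `|v + w.2| ^+ 2 - m.
  have := lH 0 w; rewrite /H (linear0 (A 0)) (linear0 v) (linear0 A).
  rewrite (add0r w.1) (addr0 v); lra.
have [z' z'E] : exists z' : dual X, forall a, z' a = l (a, 0).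
  apply: (@dual_of_upper_bounded _ _ (2^-1 + 2^-1 * `|v| ^+ 2 - m)) => [s a b|a a1].
    rewrite -ll; congr l; apply/pair_equal_spec; split => //=.
    by rewrite scaler0 addr0.
  apply: (le_trans (bound1 _)); rewrite /= addr0.
  have : `|a| ^+ 2 <= 1 by rewrite expr_le1.
  lra.
have [z'' z''E] : exists z'' : dual (dual X), forall b, z'' b = l (0, b).
  apply: (@dual_of_upper_bounded _ _ (2^-1 * (`|v| + 1) ^+ 2 - m)) => [s a b|b b1].
    rewrite -ll; congr l; apply/pair_equal_spec; split => //=.
    by rewrite scaler0 addr0.
  apply: (le_trans (bound1 _)); rewrite /= normr0 expr0n/= mulr0 add0r.
  rewrite lerD2r ler_pM2l// ler_pXn2r ?nnegrE ?addr_ge0//.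
  by apply: (le_trans (ler_normD _ _)); rewrite lerD2l.
have lE a b : l (a, b) = z' a + z'' b.
  rewrite z'E z''E -lD; congr l.
  by apply/pair_equal_spec; split; rewrite /= ?addr0 ?add0r.
have [z _ zE] := rX z'' I.
have {zE} zE b : z'' b = b z by rewrite -zE.
(* [lH] at [u = - z], in shifted variables that turn the two norms into those of
   [a] and [b]. *)
have key a b : z' a + z'' b <= 2^-1 * `|a| ^+ 2 + 2^-1 * `|b| ^+ 2 - m - z' z.
  have := lH (- z) (a + z, b - v + A z).
  rewrite /H lE /= (linearN A) (linearN v) linearD !zE !lincont_addE.
  rewrite (_ : (- A z) (- z) = A z z); last by rewrite linearN; exact: opprK.
  rewrite (_ : (- v) z = - v z)// (_ : - z + (a + z) = a); last first.
    by rewrite addrCA addNr addr0.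
  rewrite (_ : v - A z + (b - v + A z) = b); first by lra.
  by rewrite addrA addrAC subrK addrC subrK.
have zz : `|z' z| <= `|z'| * `|z''| by rewrite -zE mulrC le_lincont_norm.
have hz'' a : 2^-1 * `|z''| ^+ 2 <= 2^-1 * `|a| ^+ 2 - m - z' z - z' a.
  by apply: half_sqr_dual_norm_le => b; have := key a b; lra.
have : 2^-1 * `|z'| ^+ 2 <= - m - z' z - 2^-1 * `|z''| ^+ 2.
  by apply: half_sqr_dual_norm_le => a; have := hz'' a; lra.
have := sqr_ge0 (`|z'| - `|z''|).
by move: zz; rewrite ler_norml => /andP[]; lra.
Qed.

End rockafellar.

(** * The Fitzpatrick function and the three representers *)

(** The change of variable behind every evaluation of a supremum below; [l]
    inverts the substitution [k], so that all of [U] is reached. *)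
Lemma ereal_sup_affine {R : realType} {T U : Type} (k : T -> U) (l : U -> T) (f : T -> R)
    (g : U -> R) (a b : R) : 0 < b -> cancel l k ->
  (forall x, f x = a + b * g (k x)) ->
  (ereal_sup (range (EFin \o f)) = a%:E + b%:E * ereal_sup (range (EFin \o g)))%E.
Proof.
move=> b0 lK fE; apply/eqP; rewrite eq_le; apply/andP; split.
  apply/ereal_supP => _ [x _ <-] /=; rewrite fE EFinD EFinM.
  rewrite leeD2l// lee_pmul2l// ?lte_fin//.
  by apply: ereal_sup_ubound; exists (k x).
rewrite addeC -leeBrDr// -lee_pdivlMl//; apply/ereal_supP => _ [u _ <-].
rewrite lee_pdivlMl// leeBrDr// addeC /= -EFinM -EFinD.
by apply: ereal_sup_ubound; exists (l u) => //=; rewrite fE lK.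
Qed.

Section quadratic_conjugate.
Context {R : realType} {X : normedModType R} (A : {linear_continuous X -> dual X}).
Context (mA : monotone_operator A).
Implicit Types (x y : X) (v : dual X).

Lemma dual_addE (f g : dual X) x : (f + g) x = f x + g x :> R.
Proof. by []. Qed.

Lemma dual_subE (f g : dual X) x : (f - g) x = f x - g x :> R.
Proof. by []. Qed.

Definition qconj v : \bar R := conjugate (EFin \o quad (sym_part A)) v.

Lemma quad_sym_part x : quad (sym_part A) x = 2^-1 * A x x.
Proof. rewrite /quad sym_partE; lra. Qed.

Lemma qconjE v :
  qconj v = ereal_sup (range (EFin \o (fun x => v x - 2^-1 * A x x))).
Proof.
rewrite /qconj /conjugate; congr ereal_sup; apply: eq_imagel => x _ /=.
by rewrite quad_sym_part EFinB.
Qed.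

Lemma fenchel_young v x : ((v x - 2^-1 * A x x)%:E <= qconj v)%E.
Proof. by rewrite qconjE; apply: ereal_sup_ubound; exists x. Qed.

Lemma qconj_le v c : (forall x, ((v x - 2^-1 * A x x)%:E <= c)%E) ->
  (qconj v <= c)%E.
Proof. by move=> vc; rewrite qconjE; apply/ereal_supP => _ [x _ <-]; exact: vc. Qed.

Lemma qconj_ge0 v : (0 <= qconj v)%E.
Proof.
by have := fenchel_young v 0; rewrite (linear0 v) (linear0 (A 0)) mulr0 subr0.
Qed.

Lemma qconj_cases v : qconj v = +oo%E \/ exists2 r : R, 0 <= r & qconj v = r%:E.
Proof.
have := qconj_ge0 v; case: (qconj v) => [r| |]//; last by left.
by rewrite lee_fin => r0; right; exists r.
Qed.

(** The quadratic form attains its Fenchel-Young equality at [A_+ x], because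
    [q (x - y)] is nonnegative. *)
Lemma qconj_sym_part x : qconj (sym_part A x) = (2^-1 * A x x)%:E.
Proof.
apply/eqP; rewrite eq_le; apply/andP; split; last first.
  apply: le_trans (fenchel_young _ x); rewrite lee_fin sym_partE; lra.
apply: qconj_le => y; rewrite lee_fin sym_partE.
by have := mA (x - y); rewrite !linopD !linopN !dualD !dualN; lra.
Qed.

Lemma qconjZ v (t : R) : 0 < t -> (qconj (t *: v) = (t ^+ 2)%:E * qconj v)%E.
Proof.
move=> t0; rewrite !qconjE -[RHS]add0e.
apply: (ereal_sup_affine (fun x => t^-1 *: x) (fun x => t *: x)).
- by rewrite exprn_gt0.
- by move=> x; rewrite scalerA mulVf ?scale1r// gt_eqF.
move=> x; rewrite lincont_scaleE linopZ !dualZ /GRing.scale/=.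
by field; rewrite gt_eqF.
Qed.

(** If [q*] vanishes at [v] then [v y <= q y] for all [y]; along a line the left
    side is linear and the right side quadratic, so [v] is zero. *)
Lemma qconj_eq0 v : qconj v = 0%E -> v = 0.
Proof.
move=> v0; apply/lincont_eqP => x.
have vle y : v y <= 2^-1 * A y y.
  by have := fenchel_young v y; rewrite v0 lee_fin; lra.
have [b0 t] : 0 <= A x x /\ forall t : R, t * v x <= 2^-1 * (t ^+ 2 * A x x).
  split=> // t; have := vle (t *: x); rewrite linopZ !dualZ; lra.
have b1 : A x x + 1 != 0 by apply: lt0r_neq0; lra.
(* The scaling [c] almost minimises [2^-1 * t ^+ 2 * A x x - t * v x]; adding
   [1] to [A x x] avoids dividing by zero. *)
have [c cE] : exists c : R, v x = c * (A x x + 1).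
  by exists (v x / (A x x + 1)); rewrite -mulrA mulVf// mulr1.
have c2b : 0 <= c ^+ 2 * A x x by rewrite mulr_ge0 ?sqr_ge0.
have : c ^+ 2 <= 0 by have := t c; rewrite cE; lra.
rewrite exprn_even_le0//= => /eqP c0.
by rewrite cE c0 mul0r.
Qed.

Lemma fitzpatrickE x v :
  (fitzpatrick A (x, v) = (v x)%:E + 2^-1%:E * qconj (v - A x)%R)%E.
Proof.
rewrite qconjE.
rewrite -(@ereal_sup_affine R _ _ (fun y => 2 *: (y - x)) (fun w => x + 2^-1 *: w)
  (fun y => A y x + v y - A y y)) => [|||y].
- congr ereal_sup; apply/seteqP; split.
    by move=> _ [_ [y _ <-] <-]; exists y.
  by move=> _ [y _ <-]; exists (y, A y) => //; exists y.
- by rewrite invr_gt0.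
- by move=> w /=; rewrite addrAC subrr add0r scalerA divff// scale1r.
- by rewrite dual_subE linopZ linopD linopN !dualZ !dualD !dualN; field.
Qed.

(** Any [y] gives a lower bound, through the pair [(y, w)] that is optimal for
    that [y].  On the graph the bound does not depend on [y]; off the graph it
    is affine in [y] and not constant, hence unbounded. *)
Lemma fitzpatrick_conj_ge x v y :
  ((A x x + (v - A x) y)%:E <= conjugate2 (fitzpatrick A) (v, x))%E.
Proof.
(* [2 *: A_+ (x - y)] maximises [w' (x - y) - 2^-1 * q* w'] over [w']. *)
pose w := A y + sym_part A (2 *: (x - y)).
apply: le_ereal_sup_tmp; exists ((v y + w x)%:E - fitzpatrick A (y, w))%E.
  by exists (y, w).
rewrite fitzpatrickE /w addrAC subrr add0r qconj_sym_part.
rewrite -EFinM -!EFinD lee_fin.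
rewrite dual_subE !(dual_addE (A y)) !sym_partE.
rewrite !linopZ !linopD !linopN !dualZ !dualD !dualN; lra.
Qed.

Lemma mul_half_infty : (2^-1%:E * +oo = +oo :> \bar R)%E.
Proof. by rewrite gt0_muley ?lte_fin ?invr_gt0. Qed.

Lemma fitzpatrick_conj_gra x :
  conjugate2 (fitzpatrick A) (A x, x) = (A x x)%:E.
Proof.
apply/eqP; rewrite eq_le; apply/andP; split; last first.
  by have := fitzpatrick_conj_ge x (A x) x; rewrite subrr addr0.
apply/ereal_supP => _ [[y v] _ <-] /=; rewrite fitzpatrickE.
have := fenchel_young (v - A y) (2 *: (x - y)).
have [->|[r _ ->]] := qconj_cases (v - A y).
  by rewrite mul_half_infty leNye.
rewrite -EFinM -!EFinD !lee_fin dual_subE.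
rewrite !linopZ !linopD !linopN !dualZ !dualD !dualN; lra.
Qed.

Lemma fitzpatrick_conj_notin_gra x v : v != A x ->
  conjugate2 (fitzpatrick A) (v, x) = +oo%E.
Proof.
move=> vA.
have [y vy] : exists y, (v - A x) y != 0.
  apply: contrapT => h; move/negP: vA; apply; rewrite -subr_eq0; apply/eqP.
  apply/lincont_eqP => y; apply/eqP/negPn/negP => vy; apply: h; by exists y.
apply: eq_infty => t.
have := fitzpatrick_conj_ge x v (((t - A x x) / (v - A x) y) *: y).
by rewrite dualZ divfK// addrC subrK.
Qed.

Definition common_rep (p : X * dual X) : \bar R :=
  ((p.2 p.1)%:E + qconj (p.2 - A p.1)%R)%E.

Lemma common_repE x v :
  common_rep (x, v) = ((v x)%:E + qconj (v - A x)%R)%E.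
Proof. by []. Qed.

Lemma calCE : calC A = common_rep.
Proof.
apply/funext => -[x v]; rewrite /calC /common_rep /=.
rewrite -/(qconj _) quad_sym_part !qconjE.
rewrite (@ereal_sup_affine R _ _ (fun y => y - x) (fun w => w + x) _
  (fun u => (v - A x) u - 2^-1 * A u u) (v x - 2^-1 * A x x) 1) => [|||y].
- by rewrite mul1e addeA -EFinD; congr (_%:E + _)%E; lra.
- by [].
- by move=> w; rewrite addrK.
- rewrite !(dual_subE v) skew_partE.
  rewrite !linopD !linopN !dualD !dualN; lra.
Qed.

Lemma fitzpatrick_ninfty p : fitzpatrick A p != -oo%E.
Proof.
case: p => x v; rewrite fitzpatrickE.
by have [->|[r _ ->]] := qconj_cases (v - A x); rewrite ?mul_half_infty.
Qed.

Lemma half_fitzpatrick_ninfty p : (2^-1%:E * fitzpatrick A p != -oo)%E.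
Proof.
have := fitzpatrick_ninfty p; case: (fitzpatrick A p) => //.
by rewrite mul_half_infty.
Qed.

Lemma calAE : calA A = common_rep.
Proof.
apply/funext => -[x v].
have value : (2^-1%:E * fitzpatrick A (x, v + (v - A x))%R
   + 2^-1%:E * swap (conjugate2 (fitzpatrick A)) (x, v - (v - A x))%R
   = common_rep (x, v))%E.
  rewrite /swap /= subKr fitzpatrick_conj_gra fitzpatrickE.
  have -> : v + (v - A x) - A x = 2 *: (v - A x).
    by rewrite addrAC -mulr2n -scaler_nat.
  rewrite qconjZ// /common_rep /=.
  have [->|[r _ ->]] := qconj_cases (v - A x).
    by rewrite gt0_muley ?lte_fin// !mul_half_infty.
  congr (_%:E).
  change (2^-1 * ((v + (v - A x)) x + 2^-1 * (2 ^+ 2 * r)) + 2^-1 * A x x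
          = v x + r).
  by rewrite (dual_addE v) dual_subE; field.
apply/eqP; rewrite eq_le; apply/andP; split.
  by rewrite -value; apply: ereal_inf_lbound; exists (v - A x).
apply/ereal_infP => _ [w _ <-] /=.
have [wE|wN] := eqVneq (v - w) (A x).
  by rewrite -value -wE subKr.
rewrite [swap _ _]fitzpatrick_conj_notin_gra// mul_half_infty.
by rewrite addey ?leey// half_fitzpatrick_ninfty.
Qed.

(** The pairs below are exactly those at which the conjugate term in [calB] is
    finite: their second argument lies on the graph. *)
Lemma calB_term x v u :
  (2^-1%:E * fitzpatrick A (x + u, v + (v - A x + A u))%R
   + 2^-1%:E * swap (conjugate2 (fitzpatrick A)) (x - u, v - (v - A x + A u))%R
   + (2^-1 * `|u| ^+ 2)%:E + (2^-1 * `|v - A x + A u| ^+ 2)%:E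
   = common_rep (x, v) + (A u u + (v - A x) u + 2^-1 * `|u| ^+ 2
     + 2^-1 * `|v - A x + A u| ^+ 2)%:E)%E.
Proof.
rewrite /swap [X in (_ + _ * conjugate2 _ X)%E]/=.
have -> : v - (v - A x + A u) = A (x - u).
  by rewrite opprD addrA subKr (linearB A).
rewrite fitzpatrick_conj_gra fitzpatrickE.
have -> : v + (v - A x + A u) - A (x + u) = 2 *: (v - A x).
  rewrite (linearD A) opprD (addrA v (v - A x) (A u)) addrACA subrr addr0.
  by rewrite addrAC -mulr2n -scaler_nat.
rewrite qconjZ// /common_rep /=.
have [->|[r _ ->]] := qconj_cases (v - A x).
  by rewrite gt0_muley ?lte_fin// !mul_half_infty.
congr (_%:E).
change (2^-1 * ((v + (v - A x + A u)) (x + u) + 2^-1 * (2 ^+ 2 * r))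
    + 2^-1 * A (x - u) (x - u) + 2^-1 * `|u| ^+ 2
    + 2^-1 * `|v - A x + A u| ^+ 2
  = v x + r + (A u u + (v - A x) u + 2^-1 * `|u| ^+ 2
    + 2^-1 * `|v - A x + A u| ^+ 2)).
rewrite (dual_addE v) (dual_addE (v - A x)) !dual_subE.
by rewrite !linopD !linopN !dualD !dualN; field.
Qed.

(** The upper bound is [rockafellar], applied to the lower bound
    [calB A (x, v) - common_rep (x, v)] of the remaining function of [u]. *)
Lemma calBE : reflexive_space X -> calB A = common_rep.
Proof.
move=> rX; apply/funext => -[x v].
have hge0 u : 0 <= A u u + (v - A x) u + 2^-1 * `|u| ^+ 2
     + 2^-1 * `|v - A x + A u| ^+ 2.
  have := le_lincont_norm (v - A x + A u) u; rewrite ler_norml => /andP[+ _].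
  rewrite (dual_addE (v - A x)).
  by have := sqr_ge0 (`|v - A x + A u| - `|u|); lra.
have ge : (common_rep (x, v) <= calB A (x, v))%E.
  apply/ereal_infP => _ [[u w] _ <-] /=.
  have [wE|wN] := eqVneq (v - w) (A (x - u)).
    have -> : w = v - A x + A u.
      by rewrite -[w](subKr v) wE (linearB A) opprB addrCA addrC.
    by rewrite calB_term leeDl// lee_fin.
  rewrite [swap _ _]fitzpatrick_conj_notin_gra// mul_half_infty.
  by rewrite addey ?half_fitzpatrick_ninfty// leey.
apply/eqP; rewrite eq_le ge andbT.
have le u : (calB A (x, v) <= common_rep (x, v) + (A u u + (v - A x) u
    + 2^-1 * `|u| ^+ 2 + 2^-1 * `|v - A x + A u| ^+ 2)%:E)%E.
  by rewrite -calB_term; apply: ereal_inf_lbound; exists (u, v - A x + A u).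
move: ge le; rewrite /common_rep /=.
have [->|[r _ ->]] := qconj_cases (v - A x); first by move=> _ _; rewrite leey.
case: (calB A (x, v)) => [b| |]; last 2 first.
- by move=> _ /(_ 0).
- by [].
move=> _ le; rewrite -EFinD lee_fin -subr_le0.
apply: (rockafellar A (v - A x)) => // u.
by have := le u; rewrite -!EFinD lee_fin; lra.
Qed.

(** Both inequalities are Fenchel-Young for [q]: to bound the conjugate from
    above, use it at [w - A y] with the vector [x - y] and at [v - A x] with [y - x]; to
    bound it from below, use dual points [A_+ u], where it is an equality. *)
Lemma common_rep_autoconjugate : autoconjugate common_rep.
Proof.
move=> x v; apply/eqP; rewrite eq_le; apply/andP; split.
  apply/ereal_supP => _ [[y w] _ <-] /=; rewrite /common_rep /=.
  have := fenchel_young (w - A y) (x - y); have := fenchel_young (v - A x) (y - x).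
  have [->|[s _ ->]] := qconj_cases (w - A y); first by move=> _ _; exact: leNye.
  have [->|[r _ ->]] := qconj_cases (v - A x); first by move=> _ _; exact: leey.
  rewrite -!EFinD !lee_fin.
  rewrite !dual_subE !linopD !linopN !dualD !dualN; lra.
rewrite /common_rep [leLHS]/= addeC -leeBrDr//.
apply: qconj_le => w; rewrite leeBrDr//.
apply: le_ereal_sup_tmp.
pose y := x + w; pose y' := A y + sym_part A (- w).
exists ((v y + y' x)%:E - common_rep (y, y'))%E; first by exists (y, y').
rewrite common_repE /y'.
have -> : A y + sym_part A (- w) - A y = sym_part A (- w).
  by rewrite addrAC subrr add0r.
rewrite qconj_sym_part.
rewrite -!EFinD lee_fin.
rewrite dual_subE !(dual_addE (A y)) !sym_partE /y !linopD !linopN !dualD !dualN; lra.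
Qed.

Lemma common_rep_representer : representer A common_rep.
Proof.
move=> x v; rewrite /common_rep /=; split.
  have [->|[r _ rE]] := qconj_cases (v - A x); first by [].
  rewrite rE -EFinD => -[vr].
  have /qconj_eq0/eqP : qconj (v - A x) = 0%E by rewrite rE; congr (_%:E); lra.
  by rewrite subr_eq0 => /eqP ->; exists x.
move=> [y _ [<- <-]]; rewrite subrr -(linear0 (sym_part A)) qconj_sym_part.
by rewrite (linear0 (A 0)) mulr0 adde0.
Qed.

Lemma common_rep_ninfty p : common_rep p != -oo%E.
Proof.
by rewrite /common_rep; have [->|[r _ ->]] := qconj_cases (p.2 - A p.1).
Qed.

Lemma common_rep_autoconjugate_representer :
  autoconjugate_representer A common_rep.
Proof.
split; [exact: common_rep_ninfty|exact: common_rep_autoconjugate|].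
exact: common_rep_representer.
Qed.

End quadratic_conjugate.

Local Open Scope ereal_scope.

Theorem theorem3p1 (R : realType) (X : completeNormedModType R)
    (A : {linear_continuous X -> dual X}) :
  reflexive_space X -> monotone_operator A ->
  [/\ autoconjugate_representer A (calA A),
      autoconjugate_representer A (calB A) &
      autoconjugate_representer A (calC A)] /\
  forall (x : X) (x' : dual X),
    let f := (x' x)%:E
             + conjugate (EFin \o quad (sym_part A)) (x' - A x)%R in
    [/\ calA A (x, x') = f, calB A (x, x') = f & calC A (x, x') = f].
Proof.
move=> rX mA; rewrite calAE// calBE// calCE.
by split; [split; exact: common_rep_autoconjugate_representer|].
Qed.
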